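(* Let $X\subset\mathbb{S}^3$ be a $(4,N,1/2)$ spherical code with $A(X)\subset[-1/2,1/2]$. Then $N\le12$. Furthermore, $N=12$ if and only if $X$ is a spherical $\{10,4,2\}$-design and $A(X)\subset\{-1/2,0,1/2\}$.
   Context: For $X\subset\mathbb{S}^{d-1}$, $A(X)=\{\langle x,y\rangle: x,y\in X, x\ne y\}$. A set $X$ of $N$ points of $\mathbb{S}^{d-1}$ is a $(d,N,a)$ spherical code if every element of $A(X)$ is $\le a$. $\mathrm{Harm}_\ell(\mathbb{R}^d)$ is the real space of homogeneous harmonic polynomials of degree exactly $\ell$ in $d$ variables; for $T\subset\mathbb{N}$, a nonempty finite $X\subset\mathbb{S}^{d-1}$ is a spherical $T$-design if $\sum_{x\in X}P(x)=0$ for all $P\in\mathrm{Harm}_\ell(\mathbb{R}^d)$, $\ell\in T$. *)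

(* Defs.v *)
From HB Require Import structures.
From mathcomp Require Import all_boot all_order all_algebra.
From mathcomp Require Import finmap mpoly reals.

Set Implicit Arguments.
Unset Strict Implicit.
Unset Printing Implicit Defensive.

Import Order.TTheory GRing.Theory Num.Theory.

Local Open Scope ring_scope.
Local Open Scope fset_scope.

Section SphericalCodes.
Variables (R : realType) (d : nat).
Implicit Types (x y : 'rV[R]_d) (X : {fset 'rV[R]_d}).

Definition dot x y : R := \sum_(i < d) x ord0 i * y ord0 i.

(* The unit sphere S^(d-1) for the Euclidean norm; the library norm `|x| on
   row vectors is the sup norm. *)
Definition unit_sphere : {pred 'rV[R]_d} := [pred x | Num.sqrt (dot x x) == 1].

Definition inner_products X : {fset R} :=
  [fset dot x y | x in X, y in X & x != y].

Definition spherical_code (N : nat) (a : R) X : Prop :=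
  [/\ {subset X <= unit_sphere}, #|` X| = N
    & forall t, t \in inner_products X -> t <= a].

Definition laplacian (p : {mpoly R[d]}) : {mpoly R[d]} :=
  \sum_(i < d) p^`M(i)^`M(i).

Definition Harm (l : nat) : {pred {mpoly R[d]}} :=
  [pred p | (p \is l.-homog) && (laplacian p == 0)].

Definition spherical_design (T : {pred nat}) X : Prop :=
  [/\ {subset X <= unit_sphere}, X != fset0
    & forall l, l \in T -> forall p, p \in Harm l ->
        \sum_(x <- X) p.@[fun i => x ord0 i] = 0].

End SphericalCodes.

(* Main.v *)
Require Import Defs.
From HB Require Import structures.
From mathcomp Require Import all_boot all_order all_algebra.
From mathcomp Require Import finmap mpoly reals.
From mathcomp Require Import ssrcomplements ring lra.

Set Implicit Arguments.
Unset Strict Implicit.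
Unset Printing Implicit Defensive.

Import Order.TTheory GRing.Theory Num.Theory.

Local Open Scope ring_scope.

(* Delsarte's linear programming method.  Write U_k for the Chebyshev
   polynomials of the second kind and S_k for the sum of U_k(<x, y>) over all
   pairs x, y in X.  The polynomial 17 + 32 U_2 + 16 U_4 + U_10 equals
   16 t^2 (t^2 - 1/4) (64 t^6 - 128 t^4 + 80 t^2 + 1): it is nonpositive on
   [-1/2, 1/2], vanishes there only at 0 and +-1/2, and is 12 * 17 at t = 1.
   Summing it over all pairs gives
     17 N^2 + 32 S_2 + 16 S_4 + S_10 = 12 * 17 N + (off-diagonal terms <= 0),
   so everything follows once S_k >= 0, with equality exactly when X is a
   {k}-design.  Positivity comes from the Fischer product
   <p, q> = sum_m m! p_m q_m: multiplication by 'X_i is adjoint to the partial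
   derivative, hence the zonal harmonic Z_y(x) = |x|^k U_k(<x, y> / |x|)
   satisfies <Z_y, p> = 2^k k! p(y) for p harmonic of degree k, and
   2^k k! S_k = |sum_y Z_y|^2. *)

(** * The Fischer product and Euler's identity *)

Section Fischer.
Variables (n : nat) (R : realDomainType).
Implicit Types (p q : {mpoly R[n]}) (m : 'X_{1..n}).

Definition mfact m : nat := (\prod_(i < n) (m i)`!)%N.

Definition fischer p q : R :=
  \sum_(m <- msupp p) p@_m * q@_m * (mfact m)%:R.

Lemma mfact_gt0 m : (0 < mfact m)%N.
Proof. by apply: prodn_gt0 => i; exact: fact_gt0. Qed.

Lemma mfactU i m : mfact (U_(i) + m) = ((m i).+1 * mfact m)%N.
Proof.
rewrite /mfact (bigD1 i) //= [in RHS](bigD1 i) //= mnmDE mnm1E eqxx add1n factS.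
rewrite mulnA; congr (_ * _)%N; apply: eq_bigr => j neq_ji.
by rewrite mnmDE mnm1E eq_sym (negbTE neq_ji).
Qed.

(** Any large enough degree bound gives the same sum, so one index set can serve two polynomials at
    once; this is how symmetry is obtained. *)
Lemma fischerwE k p q : (msize p <= k)%N ->
  fischer p q = \sum_(m : 'X_{1..n < k}) p@_m * q@_m * (mfact m)%:R.
Proof.
pose I : subFinType _ := 'X_{1..n < k}.
move=> le_pk; rewrite /fischer (big_mksub I) /=; first last.
  by move=> x /msize_mdeg_lt/leq_trans/(_ le_pk).
  by rewrite msupp_uniq.
by rewrite big_rmcond //= => j /memN_msupp_eq0 ->; rewrite !mul0r.
Qed.

Lemma fischerC p q : fischer p q = fischer q p.
Proof.
rewrite (@fischerwE (maxn (msize p) (msize q))) ?leq_maxl //.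
rewrite (@fischerwE (maxn (msize p) (msize q)) q) ?leq_maxr //.
by apply: eq_bigr => m _; rewrite [p@__ * _]mulrC.
Qed.

Lemma fischer_is_scalar p : scalar (fischer p).
Proof.
move=> c q r; rewrite /fischer mulr_sumr -big_split /=; apply: eq_bigr => m _.
by rewrite mcoeffD mcoeffZ; ring.
Qed.

HB.instance Definition _ p :=
  GRing.isLinear.Build R {mpoly R[n]} R _ (fischer p) (fischer_is_scalar p).

Lemma fischer_suml (I : Type) (r : seq I) (F : I -> {mpoly R[n]}) q :
  fischer (\sum_(i <- r) F i) q = \sum_(i <- r) fischer (F i) q.
Proof.
by rewrite fischerC linear_sum; apply: eq_bigr => i _; rewrite fischerC.
Qed.

Lemma fischerDl p1 p2 q : fischer (p1 + p2) q = fischer p1 q + fischer p2 q.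
Proof. by rewrite !(fischerC _ q) linearD. Qed.

Lemma fischerZl c p q : fischer (c *: p) q = c * fischer p q.
Proof. by rewrite !(fischerC _ q) linearZ. Qed.

(** The factor [(m i).+1] by which the factorial weight grows from [m] to [U_(i) + m] is exactly the
    one produced by differentiation. *)
Lemma fischer_mulX i p q : fischer (p * 'X_i) q = fischer p q^`M(i).
Proof.
rewrite /fischer (perm_big _ (msuppMX p U_(i))) big_map; apply: eq_bigr => m _.
rewrite mcoeffMX mcoeff_deriv mfactU natrM -mulr_natr [(m + _)%MM]addmC.
by ring.
Qed.

Lemma fischer_ge0 p : 0 <= fischer p p.
Proof.
by apply: sumr_ge0 => m _; rewrite mulr_ge0 ?ler0n // -expr2 sqr_ge0.
Qed.

Lemma fischer_eq0 p : fischer p p = 0 -> p = 0.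
Proof.
move/eqP; rewrite psumr_eq0; last first.
  by move=> m _; rewrite mulr_ge0 ?ler0n // -expr2 sqr_ge0.
move/allP => p0; apply/mpolyP => m; rewrite mcoeff0.
have [/p0|/memN_msupp_eq0 //] := boolP (m \in msupp p).
rewrite /= !mulf_eq0 orbb pnatr_eq0 (negbTE (lt0n_neq0 (mfact_gt0 m))) orbF.
by move/eqP.
Qed.

Lemma mcoeff_deriv_mulX i p m : (p^`M(i) * 'X_i)@_m = p@_m *+ m i.
Proof.
(* If [m i = 0], no multiple of ['X_i] contains the monomial [m]; otherwise [U_(i)] can be split off
   from [m]. *)
have [mi0|] := eqVneq (m i) 0%N.
  rewrite mi0 mulr0n; apply: memN_msupp_eq0.
  rewrite (perm_mem (msuppMX _ _)); apply/mapP => -[m' _ eq_m].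
  by move: mi0; rewrite eq_m mnmDE mnm1E eqxx.
rewrite -lep1mP => /submK <-.
rewrite [(_ + U_(i))%MM]addmC mcoeffMX mcoeff_deriv.
by rewrite addmC mnmDE mnm1E eqxx.
Qed.

Lemma euler_homog k p : p \is k.-homog -> \sum_i p^`M(i) * 'X_i = p *+ k.
Proof.
move=> homp; apply/mpolyP => m; rewrite raddf_sum /= mcoeffMn.
under eq_bigr do rewrite mcoeff_deriv_mulX.
rewrite sumrMnr -mdegE.
have [->//|/(dhomog_nemf_coeff homp) ->] := eqVneq (mdeg m) k.
by rewrite !mul0rn.
Qed.

Lemma dhomog_deriv k i p : p \is k.+1.-homog -> p^`M(i) \is k.-homog.
Proof.
move=> homp; apply/dhomogP => m; rewrite mcoeff_msupp mcoeff_deriv.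
apply: contraNeq => neq_mk.
rewrite (dhomog_nemf_coeff homp) ?mul0rn //.
by rewrite /= mdegD mdeg1 addn1 eqSS.
Qed.

End Fischer.

(** * Zonal polynomials and their reproducing property *)

Section Zonal.
Variables (n : nat) (R : realType).
Implicit Types (p q : {mpoly R[n]}) (x y : 'rV[R]_n).

Definition linform y : {mpoly R[n]} := \sum_i y ord0 i *: 'X_i.

Definition sqnorm : {mpoly R[n]} := \sum_i 'X_i * 'X_i.

Definition dderiv y p : {mpoly R[n]} := \sum_i y ord0 i *: p^`M(i).

(* For |y| = 1 in dimension 4: |x|^k U_k(<x, y> / |x|), as a polynomial in x. *)
Fixpoint zonal y (k : nat) : {mpoly R[n]} :=
  match k with
  | 0 => 1
  | k1.+1 => match k1 with
    | 0 => linform y *+ 2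
    | k2.+1 => linform y * zonal y k1 *+ 2 - sqnorm * zonal y k2
    end
  end.

Lemma zonalSS y k :
  zonal y k.+2 = linform y * zonal y k.+1 *+ 2 - sqnorm * zonal y k.
Proof. by []. Qed.

Lemma nat_ind2 (P : nat -> Prop) :
  P 0%N -> P 1%N -> (forall k, P k -> P k.+1 -> P k.+2) -> forall k, P k.
Proof.
move=> P0 P1 PS k; suff [] : P k /\ P k.+1 by [].
by elim: k => // k [Pk Pk1]; split=> //; apply: PS.
Qed.

Lemma fischer_mul_linform y p q :
  fischer (p * linform y) q = fischer p (dderiv y q).
Proof.
rewrite mulr_sumr fischer_suml linear_sum; apply: eq_bigr => i _.
by rewrite -scalerAr fischerZl fischer_mulX linearZ.
Qed.

Lemma fischer_mul_sqnorm p q :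
  fischer (p * sqnorm) q = fischer p (laplacian q).
Proof.
rewrite mulr_sumr fischer_suml linear_sum; apply: eq_bigr => i _.
by rewrite mulrA !fischer_mulX.
Qed.

Lemma dhomog_dderiv k y p : p \is k.+1.-homog -> dderiv y p \is k.-homog.
Proof.
by move=> homp; apply: rpred_sum => i _; apply/rpredZ/dhomog_deriv.
Qed.

(** Each factor [linform y] moves across as a derivative along [y]; evaluated at [y], Euler's
    identity makes that derivative multiply by the degree, and the degrees build up [k!]. *)
Lemma fischer_linformX k y p : p \is k.-homog ->
  fischer (linform y ^+ k) p = p.@[fun i => y ord0 i] *+ k`!.
Proof.
elim: k p => [|k IHk] p homp.
  rewrite expr0 /fischer msupp1 big_seq1 mcoeff1 eqxx mul1r.
  have -> : p = (p@_0)%:MP.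
    apply/mpolyP => m; rewrite mcoeffC.
    have [->|m_neq0] := eqVneq m 0%MM; first by rewrite mulr1.
    by rewrite (dhomog_nemf_coeff homp) ?mdeg_eq0 // mulr0.
  rewrite mevalC mcoeffC eqxx mulr1 mulr1n /mfact.
  by rewrite big1 ?mulr1 // => i _; rewrite mnm0E.
rewrite exprSr fischer_mul_linform IHk ?dhomog_dderiv //.
rewrite factS mulrnA; congr (_ *+ _); rewrite -mevalMn -(euler_homog homp).
rewrite !rmorph_sum; apply: eq_bigr => i _.
by rewrite /= mevalZ mevalM mevalXU mulrC.
Qed.

Lemma dhomog_linform y : linform y \is 1.-homog.
Proof. by apply: rpred_sum => i _; rewrite rpredZ // dhomogX /= mdeg1. Qed.

Lemma dhomog_sqnorm : sqnorm \is 2.-homog.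
Proof.
apply: rpred_sum => i _.
have homX : ('X_i : {mpoly R[n]}) \is 1.-homog by rewrite dhomogX /= mdeg1.
exact: (dhomogM homX homX).
Qed.

Lemma dhomog_zonal y k : zonal y k \is k.-homog.
Proof.
elim/nat_ind2: k => [||k IHk IHk1]; first exact: dhomog1.
  by rewrite rpredMn ?dhomog_linform.
rewrite zonalSS rpredB ?rpredMn //.
  exact: (dhomogM (dhomog_linform y) IHk1).
exact: (dhomogM dhomog_sqnorm IHk).
Qed.

(** By adjunction, multiples of [sqnorm] are Fischer-orthogonal to harmonic polynomials, so only the
    power of [linform y] counts in [fischer_zonal]. *)
Lemma zonal_modulo_sqnorm y k :
  exists q, zonal y k = linform y ^+ k *+ 2 ^ k + q * sqnorm.
Proof.
elim/nat_ind2: k => [||k [q eq0] [q1 eq1]].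
  by exists 0; rewrite mul0r addr0.
  by exists 0; rewrite mul0r addr0.
rewrite zonalSS eq1 eq0.
exists (linform y * q1 *+ 2 - linform y ^+ k *+ 2 ^ k - q * sqnorm).
rewrite !exprS !expnS; move: (2 ^ k)%N => c.
by ring.
Qed.

Lemma fischer_zonal y k p : p \in Harm k ->
  fischer (zonal y k) p = p.@[fun i => y ord0 i] *+ (2 ^ k * k`!).
Proof.
rewrite inE => /andP[homp /eqP lap0].
have [q ->] := zonal_modulo_sqnorm y k.
rewrite fischerDl fischer_mul_sqnorm lap0 linear0 addr0 -scaler_nat fischerZl.
by rewrite fischer_linformX // mulr_natl mulnC mulrnA.
Qed.

(** * Derivatives and harmonicity of the zonal polynomials *)

Lemma mderivXU i j : ('X_j : {mpoly R[n]})^`M(i) = (i == j)%:R.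
Proof.
rewrite mderivX mnm1E eq_sym; case: eqVneq => [->|_]; last by rewrite scale0r.
by rewrite -{1}[U_(j)%MM]add0m addmK mpolyX0 scale1r.
Qed.

Lemma mderiv_linform i y : (linform y)^`M(i) = (y ord0 i)%:MP.
Proof.
rewrite linear_sum (bigD1 i) //= big1 => [|j neq_ji];
  rewrite linearZ /= mderivXU.
  by rewrite eqxx addr0 alg_mpolyC.
by rewrite eq_sym (negbTE neq_ji) scaler0.
Qed.

Lemma mderiv_sqnorm i : sqnorm^`M(i) = 'X_i *+ 2.
Proof.
rewrite linear_sum (bigD1 i) //= big1 => [|j neq_ji]; rewrite mderivM mderivXU.
  by rewrite eqxx addr0 mul1r mulr1 mulr2n.
by rewrite eq_sym (negbTE neq_ji) mul0r mulr0 addr0.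
Qed.

Lemma dderiv_is_linear y : linear (dderiv y).
Proof.
move=> c p q; rewrite scaler_sumr -big_split; apply: eq_bigr => i _ /=.
by rewrite linearP scalerDr !scalerA mulrC.
Qed.

HB.instance Definition _ y := GRing.isLinear.Build R {mpoly R[n]} {mpoly R[n]}
  _ (dderiv y) (dderiv_is_linear y).

Lemma laplacian_is_linear : linear (@laplacian R n).
Proof.
move=> c p q; rewrite scaler_sumr -big_split; apply: eq_bigr => i _ /=.
by rewrite !linearP.
Qed.

HB.instance Definition _ := GRing.isLinear.Build R {mpoly R[n]} {mpoly R[n]}
  _ (@laplacian R n) laplacian_is_linear.

Lemma dderivM y p q : dderiv y (p * q) = dderiv y p * q + p * dderiv y q.
Proof.
rewrite mulr_suml mulr_sumr -big_split; apply: eq_bigr => i _ /=.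
by rewrite mderivM scalerDr scalerAl scalerAr.
Qed.

Lemma dderiv1 y : dderiv y 1 = 0.
Proof. by apply: big1 => i _; rewrite -mpolyC1 mderivC scaler0. Qed.

Lemma dderiv_linform y : dderiv y (linform y) = (dot y y)%:MP.
Proof.
rewrite [RHS]rmorph_sum; apply: eq_bigr => i _.
by rewrite mderiv_linform -mul_mpolyC -rmorphM.
Qed.

Lemma dderiv_sqnorm y : dderiv y sqnorm = linform y *+ 2.
Proof.
rewrite -sumrMnl; apply: eq_bigr => i _.
by rewrite mderiv_sqnorm scalerMnr.
Qed.

Lemma laplacianM p q : laplacian (p * q) =
  laplacian p * q + p * laplacian q + (\sum_i p^`M(i) * q^`M(i)) *+ 2.
Proof.
rewrite mulr_suml mulr_sumr -sumrMnl -!big_split; apply: eq_bigr => i _ /=.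
by rewrite mderivM mderivD !mderivM; ring.
Qed.

Lemma laplacian_linformM y p :
  laplacian (linform y * p) = linform y * laplacian p + dderiv y p *+ 2.
Proof.
rewrite laplacianM; congr (_ + _ *+ _).
  rewrite [laplacian _]big1 ?mul0r ?add0r // => i _.
  by rewrite mderiv_linform mderivC.
by apply: eq_bigr => i _; rewrite mderiv_linform mul_mpolyC.
Qed.

(** The Laplacian of [sqnorm] contributes [2 n], and the cross term contributes [4 k] through
    Euler's identity. *)
Lemma laplacian_sqnormM k p : p \is k.-homog ->
  laplacian (sqnorm * p) = sqnorm * laplacian p + p *+ (n + k.*2).*2.
Proof.
move=> homp; rewrite laplacianM.
have -> : laplacian sqnorm = (n.*2)%:R.
  rewrite /laplacian.
  under eq_bigr do rewrite mderiv_sqnorm linearMn /= mderivXU eqxx.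
  by rewrite sumr_const card_ord -mulrnA mul2n.
have -> : \sum_i sqnorm^`M(i) * p^`M(i) = p *+ k.*2.
  rewrite -muln2 mulrnA -(euler_homog homp) -sumrMnl; apply: eq_bigr => i _.
  by rewrite mderiv_sqnorm; ring.
by rewrite -!muln2; ring.
Qed.

Lemma dderiv_zonal y k : dot y y = 1 ->
  dderiv y (zonal y k.+1) = zonal y k *+ k.+2.
Proof.
move=> y1; elim/nat_ind2: k => [||k IHk IHk1].
- by rewrite linearMn /= dderiv_linform y1.
- rewrite zonalSS /= linearB linearMn /= !dderivM linearMn /=.
  rewrite dderiv_linform dderiv_sqnorm y1 mulr1.
  by rewrite dderiv1; ring.
(* Beside [2 Z_(k+2)] this leaves [k + 2] times [2 L Z_(k+1) - |x|^2 Z_k], with [L] the linear form,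
   which the recurrence folds back into [Z_(k+2)]. *)
- rewrite zonalSS linearB linearMn /= !dderivM IHk1 IHk.
  rewrite dderiv_linform dderiv_sqnorm y1 mpolyC1 /=.
  by ring.
Qed.

End Zonal.

(* The term 4 (k + 2) coming from the linear form cancels the term 2 (n + 2 k)
   coming from [sqnorm] exactly when n = 4. *)
Lemma laplacian_zonal (R : realType) (y : 'rV[R]_4) k : dot y y = 1 ->
  laplacian (zonal y k) = 0.
Proof.
move=> y1; have lap1 : laplacian (1 : {mpoly R[4]}) = 0.
  by apply: big1 => i _; rewrite -mpolyC1 !mderivC.
elim/nat_ind2: k => [||k IHk IHk1] //.
  rewrite linearMn /= -[linform y]mulr1 laplacian_linformM lap1 mulr0 add0r.
  by rewrite dderiv1 !mul0rn.
rewrite zonalSS linearB linearMn /= laplacian_linformM.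
rewrite (laplacian_sqnormM (dhomog_zonal y k)) IHk IHk1 dderiv_zonal //.
by rewrite -!muln2; ring.
Qed.

(** * Chebyshev sums over a code: positivity and the design criterion *)

Section Chebyshev.
Variable R : realType.
Implicit Types (t : R) (k : nat).

(* U_k, up to scaling the Gegenbauer polynomials of the 3-sphere. *)
Fixpoint cheb t k : R :=
  match k with
  | 0 => 1
  | k1.+1 => match k1 with
    | 0 => t *+ 2
    | k2.+1 => t * cheb t k1 *+ 2 - cheb t k2
    end
  end.

Lemma meval_zonal n (x y : 'rV[R]_n) k : dot x x = 1 ->
  (zonal y k).@[fun i => x ord0 i] = cheb (dot x y) k.
Proof.
move=> x1; have evL : (linform y).@[fun i => x ord0 i] = dot x y.
  by rewrite rmorph_sum; apply: eq_bigr => i _; rewrite /= mevalZ mevalXU mulrC.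
have evQ : (sqnorm n R).@[fun i => x ord0 i] = 1.
  by rewrite -x1 rmorph_sum; apply: eq_bigr => i _; rewrite /= mevalM mevalXU.
elim/nat_ind2: k => [||k IHk IHk1]; first exact: meval1.
  by rewrite mevalMn evL.
by rewrite zonalSS mevalB mevalMn !mevalM evL evQ IHk IHk1 mul1r.
Qed.

Section CodeSum.
Variables (s : seq 'rV[R]_4) (k : nat).
Hypothesis s1 : forall x, x \in s -> dot x x = 1.

Definition cheb_sum : R := \sum_(x <- s) \sum_(y <- s) cheb (dot x y) k.

(** Up to the factor [2 ^ k * k!], [Z] represents the functional summing a harmonic polynomial over
    [s]; its own Fischer square is thus a positive multiple of [cheb_sum]. *)
Let Z : {mpoly R[4]} := \sum_(y <- s) zonal y k.

Let Z_harm : Z \in Harm k.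
Proof.
rewrite inE; apply/andP; split.
  by apply: rpred_sum => y _; exact: dhomog_zonal.
rewrite linear_sum big_seq big1 // => y /s1 y1; exact: laplacian_zonal.
Qed.

Let fischer_Z (p : {mpoly R[4]}) : p \in Harm k ->
  fischer Z p = (\sum_(x <- s) p.@[fun i => x ord0 i]) *+ (2 ^ k * k`!).
Proof.
move=> harm_p; rewrite fischer_suml -sumrMnl.
by apply: eq_bigr => y _; rewrite fischer_zonal.
Qed.

Let cheb_sumE : cheb_sum = \sum_(x <- s) Z.@[fun i => x ord0 i].
Proof.
rewrite /cheb_sum !big_seq; apply: eq_bigr => x /s1 x1.
by rewrite rmorph_sum; apply: eq_bigr => y _; rewrite /= meval_zonal.
Qed.

Let c_gt0 : (0 < 2 ^ k * k`!)%N.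
Proof. by rewrite muln_gt0 expn_gt0 fact_gt0. Qed.

Lemma cheb_sum_ge0 : 0 <= cheb_sum.
Proof.
by rewrite cheb_sumE -(pmulrn_lge0 _ c_gt0) -fischer_Z // fischer_ge0.
Qed.

(** A zero sum forces [Z = 0] by definiteness, which kills the functional it represents; conversely,
    the design condition is tested on [Z] itself. *)
Lemma cheb_sum_eq0P : cheb_sum = 0 <->
  (forall p : {mpoly R[4]}, p \in Harm k ->
     \sum_(x <- s) p.@[fun i => x ord0 i] = 0).
Proof.
split=> [S0 p harm_p|/(_ Z Z_harm)]; last by rewrite cheb_sumE.
have Z0 : Z = 0.
  by apply: fischer_eq0; rewrite fischer_Z // -cheb_sumE S0 mul0rn.
apply/eqP; have := fischer_Z harm_p; rewrite Z0 fischerC linear0 => /esym/eqP.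
by rewrite mulrn_eq0 (negbTE (lt0n_neq0 c_gt0)).
Qed.

End CodeSum.

(** * The linear programming polynomial *)

Definition lp_poly t : R := 17 + 32 * cheb t 2 + 16 * cheb t 4 + cheb t 10.

Lemma lp_polyE t : lp_poly t = 16 * t ^+ 2 * (t ^+ 2 - 1 / 4) *
  (64 * t ^+ 6 - 128 * t ^+ 4 + 80 * t ^+ 2 + 1).
Proof. by rewrite /lp_poly /=; field. Qed.

Lemma lp_poly1 : lp_poly 1 = 12 * 17.
Proof. by rewrite lp_polyE !expr1n; field. Qed.

Lemma lp_factor_gt0 t : - (1 / 2) <= t <= 1 / 2 ->
  0 < 64 * t ^+ 6 - 128 * t ^+ 4 + 80 * t ^+ 2 + 1 /\ t ^+ 2 - 1 / 4 <= 0.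
Proof.
case/andP=> t_ge t_le.
have u_le : t ^+ 2 - 1 / 4 <= 0 by nra.
split=> //; have u_ge0 := sqr_ge0 t.
(* With [u = t^2] in [[0, 1/4]], positivity follows from [u^3 >= 0] and
   [80 u - 128 u^2 = 16 u (5 - 8 u) >= 0]. *)
rewrite (exprM t 2 3) (exprM t 2 2); move: (t ^+ 2) u_le u_ge0 => u u_le u_ge0.
have u3_ge0 : 0 <= u ^+ 3 by rewrite exprn_ge0.
by nra.
Qed.

Lemma lp_poly_le0 t : - (1 / 2) <= t <= 1 / 2 -> lp_poly t <= 0.
Proof.
move=> /lp_factor_gt0[g_gt0 u_le]; rewrite lp_polyE pmulr_lle0 //.
by rewrite mulr_ge0_le0 // mulr_ge0 ?sqr_ge0.
Qed.

Lemma lp_poly_eq0 t : - (1 / 2) <= t <= 1 / 2 ->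
  (lp_poly t == 0) = (t \in [:: - (1 / 2); 0; 1 / 2]).
Proof.
move=> /lp_factor_gt0[g_gt0 _].
rewrite lp_polyE mulf_eq0 (gt_eqF g_gt0) orbF.
have -> : 16 * t ^+ 2 * (t ^+ 2 - 1 / 4) =
  16 * ((t - - (1 / 2)) * (t * t) * (t - 1 / 2)) by field.
by rewrite !mulf_eq0 pnatr_eq0 /= !subr_eq0 orbb !inE -orbA.
Qed.

Lemma lp_sum (s : seq 'rV[R]_4) :
  uniq s -> (forall x, x \in s -> dot x x = 1) ->
  17 * (size s)%:R ^+ 2
  + 32 * cheb_sum s 2 + 16 * cheb_sum s 4 + cheb_sum s 10 =
  12 * 17 * (size s)%:R
  + \sum_(x <- s) \sum_(y <- s | y != x) lp_poly (dot x y).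
Proof.
move=> uniq_s s1.
transitivity (\sum_(x <- s) \sum_(y <- s) lp_poly (dot x y)).
  rewrite /cheb_sum !mulr_sumr.
  have -> : 17 * (size s)%:R ^+ 2 = \sum_(x <- s) \sum_(y <- s) (17 : R).
    by rewrite !big_const_seq !count_predT !iter_addr_0; ring.
  rewrite -!big_split; apply: eq_bigr => x _ /=.
  by rewrite !mulr_sumr -!big_split.
rewrite (_ : _ * (size s)%:R = \sum_(x <- s) (12 * 17)); last first.
  by rewrite big_const_seq count_predT iter_addr_0 mulr_natr.
rewrite -big_split !big_seq; apply: eq_bigr => x xs /=.
(* Since [s] has no repetition, the diagonal term [y = x] occurs exactly once. *)
by rewrite (bigD1_seq x) //= (s1 x xs) lp_poly1.
Qed.

End Chebyshev.

(** * The bound and its equality case *)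

Theorem theorem3p3 (R : realType) (N : nat) (X : {fset 'rV[R]_4})
    (hX : spherical_code N (1 / 2) X)
    (hA : {subset inner_products X <= `[- (1 / 2), 1 / 2]}) :
  (N <= 12)%N /\
  (N = 12%N <->
   spherical_design (mem [:: 10; 4; 2]%N) X /\
   {subset inner_products X <= [:: - (1 / 2); 0; 1 / 2]}).
Proof.
case: hX => sphX cardX _.
have X1 x : x \in X -> dot x x = 1.
  move=> /sphX; rewrite inE => /eqP sqrt1.
  have dot_ge0 : 0 <= dot x x by apply: sumr_ge0 => i _; rewrite -expr2 sqr_ge0.
  by rewrite -(sqr_sqrtr dot_ge0) sqrt1 expr1n.
have dotX x y : x \in X -> y \in X -> y != x -> dot x y \in inner_products X.
  move=> xX yX neq_yx; apply/imfset2P; exists x => //; exists y => //.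
  by rewrite inE /= yX eq_sym.
have dot_bnd x y :
    x \in X -> y \in X -> y != x -> - (1 / 2) <= dot x y <= 1 / 2.
  by move=> xX yX neq_yx; move: (hA _ (dotX x y xX yX neq_yx)); rewrite in_itv.
set off := \sum_(x <- X) \sum_(y <- X | y != x) lp_poly (dot x y).
have off_le0 : off <= 0.
  rewrite /off big_seq; apply: sumr_le0 => x xX; rewrite big_seq_cond.
  by apply: sumr_le0 => y /andP[yX neq_yx]; exact/lp_poly_le0/dot_bnd.
have off_eq0 :
    off = 0 <-> {subset inner_products X <= [:: - (1 / 2); 0; 1 / 2]}.
  split=> [off0 t|sub].
    case/imfset2P=> x /= xX [y] /=; rewrite inE /= => /andP[yX neq_xy] ->.
    have neq_yx : y != x by rewrite eq_sym.
    (* Negation turns [off] into a sum of nonnegative terms, so its vanishing forces each term to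
       vanish. *)
    rewrite -lp_poly_eq0 ?dot_bnd //; apply/eqP/oppr_inj; rewrite oppr0.
    have ge0 z w : z \in X -> (w \in X) && (w != z) -> 0 <= - lp_poly (dot z w).
      by move=> zX /andP[wX neq_wz]; rewrite oppr_ge0;
        exact/lp_poly_le0/dot_bnd.
    move/eqP: off0; rewrite -oppr_eq0 /off -sumrN big_seq psumr_eq0; last first.
      by move=> z zX; rewrite -sumrN big_seq_cond;
        apply: sumr_ge0 => w; exact: ge0.
    move/allP/(_ x xX)/implyP/(_ xX); rewrite -sumrN big_seq_cond.
    rewrite psumr_eq0 => [|w]; last exact: ge0.
    by move/allP/(_ y yX)/implyP => /(_ _)/eqP; apply; rewrite yX.
  rewrite /off big_seq big1 // => x xX; rewrite big_seq_cond big1 // => y.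
  case/andP=> yX neq_yx; apply/eqP; rewrite lp_poly_eq0 ?dot_bnd //.
  exact/sub/dotX.
have S2_ge0 := cheb_sum_ge0 2 X1.
have S4_ge0 := cheb_sum_ge0 4 X1.
have S10_ge0 := cheb_sum_ge0 10 X1.
have := lp_sum (fset_uniq X) X1; rewrite -/off cardX => sum_eq.
have N_le12 : (N <= 12)%N.
  (* The identity yields [17 N^2 <= 12 * 17 N]; cancelling [N] requires [N > 0], so [N = 0] is set
     apart. *)
  case: N cardX sum_eq => // N' _ sum_eq.
  by rewrite -(ler_nat R) -(ler_pM2r (ltr0Sn R N')); nra.
split=> //; split=> [N12|[[_ X_neq0 design] sub]].
  rewrite N12 in sum_eq.
  (* At [N = 12] the terms [17 N^2] and [12 * 17 N] cancel, leaving a nonnegative combination of the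
     three sums equal to [off <= 0]; hence all four vanish. *)
  have [S2 S4 S10 off0] : [/\ cheb_sum X 2 = 0, cheb_sum X 4 = 0,
      cheb_sum X 10 = 0 & off = 0] by split; lra.
  split; last exact/off_eq0.
  split=> [//||l]; first by rewrite -cardfs_gt0 cardX N12.
  by rewrite !inE => /or3P[] /eqP ->; apply/(cheb_sum_eq0P _ X1).
have S0 k : k \in [:: 10; 4; 2]%N -> cheb_sum X k = 0.
  by move=> /design harm0; apply/(cheb_sum_eq0P k X1).
move: sum_eq; rewrite !S0 // (off_eq0.2 sub) => sum_eq.
(* What remains is [17 N^2 = 12 * 17 N]; a design is nonempty by definition, so [N] cancels. *)
have N_gt0 : (0 < N%:R :> R) by rewrite ltr0n -cardX cardfs_gt0.
apply/eqP; rewrite -(eqr_nat R) -(inj_eq (mulIf (lt0r_neq0 N_gt0))).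
by apply/eqP; lra.
Qed.
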